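(* The kernels $\mathcal{K}^{\mathrm{Pk}}$ and $\mathcal{K}^{\mathrm{pk}}$ of the peak set and peak number statistics are spanned (as $\mathbb{Q}$-vector spaces) in the following ways: (a) $\mathcal{K}^{\mathrm{Pk}}=\mathrm{span}\{F_J-F_K : J\rightarrow_1 K\text{ or }J\rightarrow_2 K\}$; (b) $\mathcal{K}^{\mathrm{pk}}=\mathrm{span}\{F_J-F_K : J\rightarrow_1 K,\ J\rightarrow_2 K,\text{ or }J\rightarrow_3 K\}$. Here $J,K$ range over all compositions.
   Context: A permutation of length $n$ is a word $\pi=\pi_1\cdots\pi_n$ of $n$ distinct positive integers. Its descent composition is the composition whose parts are the lengths of its maximal increasing consecutive subsequences, in order. An index $i\in\{2,\dots,n-1\}$ is a peak of $\pi$ if $\pi_{i-1}<\pi_i>\pi_{i+1}$; $\mathrm{Pk}\,\pi$ is the set of peaks and $\mathrm{pk}\,\pi$ the number of peaks. Both depend only on the descent composition, so for a composition $L$ write $\mathrm{Pk}\,L$, $\mathrm{pk}\,L$ for their values on any permutation with descent composition $L$. For $\mathrm{st}\in\{\mathrm{Pk},\mathrm{pk}\}$, compositions $J,K$ satisfy $J\sim_{\mathrm{st}}K$ if $\mathrm{st}\,J=\mathrm{st}\,K$ and $|J|=|K|$ ($|L|$ is the sum of the parts; the empty composition of $0$ is allowed). For $L=(j_1,\dots,j_m)$ with $|L|=n$, let $\mathrm{Des}\,L=\{j_1,j_1+j_2,\dots,j_1+\cdots+j_{m-1}\}$ and $F_L=\sum x_{i_1}\cdots x_{i_n}$, summed over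 positive integers $i_1\le\cdots\le i_n$ with $i_j<i_{j+1}$ whenever $j\in\mathrm{Des}\,L$. The $F_L$ form a basis of the $\mathbb{Q}$-algebra $\mathrm{QSym}$ of quasisymmetric functions. The kernel of $\mathrm{st}$ is $\mathcal{K}^{\mathrm{st}}=\mathrm{span}_{\mathbb{Q}}\{F_J-F_K : J\sim_{\mathrm{st}}K\}$. (It is known that $\mathcal{K}^{\mathrm{Pk}}$ and $\mathcal{K}^{\mathrm{pk}}$ are ideals of $\mathrm{QSym}$; this is not part of the claim.) For compositions $J=(j_1,\dots,j_m)$ and $K$, with $[m]=\{1,\dots,m\}$: - $J\rightarrow_1K$ if there exists $l\in[m]$ with $j_l>2$ and $K=(j_1,\dots,j_{l-1},1,j_l-1,j_{l+1},\dots,j_m)$; - $J\rightarrow_2K$ if $j_m=2$ and $K=(j_1,\dots,j_{m-1},1,1)$; - $J\rightarrow_3K$ if $j_i\le2$ for all $i\in[m]$, $j_m=1$, and for some $l\in[m-2]$ we have $j_l=1$, $j_{l+1}=2$ and $K=(j_1,\dots,j_{l-1},j_{l+1},j_l,j_{l+2},\dots,j_m)$. *)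

(* Defs.v *)
From HB Require Import structures.
From mathcomp Require Import all_boot all_order all_algebra finmap multiset.
From mathcomp Require Import boolp classical_sets functions.

Set Implicit Arguments.
Unset Strict Implicit.
Unset Printing Implicit Defensive.

Import GRing.Theory.

Local Open Scope mset_scope.
Local Open Scope nat_scope.

Record composition := Composition {
  parts :> seq nat;
  parts_gt0 : all (ltn 0) parts
}.

HB.instance Definition _ := [isSub for parts].
HB.instance Definition _ := [Countable of composition by <:].

Definition Des (L : composition) : seq nat :=
  [seq sumn (take k L) | k <- iota 1 (size L).-1].

(* Permutations are words of distinct positive integers, not necessarily
   1, ..., n.  The letter written pi_i on paper is [nth 0 p i.-1]. *)
Definition is_perm (p : seq nat) : bool := uniq p && all (ltn 0) p.

(* [x] is the last letter read, [k] the length so far of the current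
   increasing run. *)
Fixpoint run_lengths (x k : nat) (s : seq nat) : seq nat :=
  if s is y :: s' then
    if x < y then run_lengths y k.+1 s' else k :: run_lengths y 1 s'
  else [:: k].

Definition descent_comp (p : seq nat) : seq nat :=
  if p is x :: s then run_lengths x 1 s else [::].

Definition is_peak (p : seq nat) (i : nat) : bool :=
  (nth 0 p i.-2 < nth 0 p i.-1) && (nth 0 p i < nth 0 p i.-1).

(* [iota 2 (n - 2)] enumerates 2, ..., n - 1. *)
Definition Pk (p : seq nat) : {fset nat} :=
  [fset i in iota 2 (size p - 2) | is_peak p i]%fset.

Definition pk (p : seq nat) : nat := #|` Pk p|%fset.

(* A permutation with a prescribed descent composition: consecutive blocks of
   increasing runs, every block lying above all the later ones. *)
Fixpoint perm_of (L : seq nat) : seq nat :=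
  if L is j :: L' then iota (sumn L').+1 j ++ perm_of L' else [::].

(* By [PkcE] and [pkcE] below, the choice of the permutation is immaterial. *)
Definition Pkc (L : composition) : {fset nat} := Pk (perm_of L).
Definition pkc (L : composition) : nat := pk (perm_of L).

Definition st_equiv (T : Type) (st : composition -> T) (J K : composition) :
  Prop := st J = st K /\ sumn J = sumn K.

(* Formal power series over rat in x_1, x_2, ...: a monomial is the multiset
   of the indices of its variables, and a series maps monomials to
   coefficients.  The index 0 is not used. *)
Notation series := ({mset nat} -> rat^o)%R.

Definition F_word (L : composition) (i : seq nat) : bool :=
  [&& size i == sumn L, all (ltn 0) i, sorted leq i &
      all (fun j => nth 0 i j.-1 < nth 0 i j) (Des L)].

(* The words i with x_{i_1} ... x_{i_n} equal to the monomial m are the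
   (pairwise distinct) elements of [permutations m]; the coefficient of m
   counts those allowed by L. *)
Definition F (L : composition) : series :=
  fun m => (count (F_word L) (permutations m))%:R%R.

Definition lspan (R : pzRingType) (V : lmodType R) (A : set V) : set V :=
  [set v | exists (n : nat) (c : 'I_n -> R) (a : 'I_n -> V),
     (forall i, A (a i)) /\ v = (\sum_(i < n) c i *: a i)%R]%classic.

Definition F_diffs (r : composition -> composition -> Prop) : set series :=
  [set f | exists J K, r J K /\ f = (F J - F K)%R]%classic.

Definition kernel (T : Type) (st : composition -> T) : set series :=
  lspan (F_diffs (st_equiv st)).

Definition arrow1 (J K : composition) : Prop :=
  exists (s t : seq nat) (j : nat),
    [/\ 2 < j, J = s ++ j :: t :> seq nat &
        K = s ++ 1 :: j.-1 :: t :> seq nat].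

Definition arrow2 (J K : composition) : Prop :=
  exists s : seq nat,
    J = s ++ [:: 2] :> seq nat /\ K = s ++ [:: 1; 1] :> seq nat.

(* Since J ends in 1, [t] is nonempty: the position l = size s + 1 of the
   swapped part 1 is at most m - 2. *)
Definition arrow3 (J K : composition) : Prop :=
  [/\ all (fun j => j <= 2) J, last 0 J = 1 &
      exists s t : seq nat,
        J = s ++ [:: 1, 2 & t] :> seq nat /\
        K = s ++ [:: 2, 1 & t] :> seq nat].

Lemma mem_permutations_mset (i : seq nat) (m : {mset nat}) :
  (i \in permutations m) = (seq_mset i == m).
Proof.
rewrite mem_permutations; apply/idP/eqP => [/eq_seq_msetP -> | <-].
  exact: seq_mset_id.
by rewrite perm_sym perm_eq_seq_mset.
Qed.

Lemma run_lengths_word x k s : 0 < k ->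
  flatten [seq false :: nseq j.-1 true | j <- run_lengths x k s] =
  false :: nseq k.-1 true ++ pairmap ltn x s.
Proof.
elim: s x k => [|y s IH] x k k_gt0 //=.
case: ifP => _ /=; last by rewrite IH.
rewrite IH //=; congr cons.
rewrite -{1}(prednK k_gt0) -[k.-1.+1]addn1 nseqD -catA /=.
by rewrite -(prednK k_gt0).
Qed.

Lemma sumn_run_lengths x k s : sumn (run_lengths x k s) = k + size s.
Proof.
elim: s x k => [|y s IH] x k /=; first by [].
by case: ifP => _ /=; rewrite IH ?addnS ?addSn ?add0n.
Qed.

Lemma sumn_descent_comp p : sumn (descent_comp p) = size p.
Proof. by case: p => //= x s; rewrite sumn_run_lengths. Qed.

Lemma descent_comp_gt0 p : all (ltn 0) (descent_comp p).
Proof.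
case: p => //= x s.
suff gt0 k : 0 < k -> all (ltn 0) (run_lengths x k s) by exact: gt0.
elim: s x k => [|y s IH] x k k_gt0 /=; first by rewrite k_gt0.
by case: ifP => _ /=; rewrite ?k_gt0 IH.
Qed.

Lemma Pk_descent_comp p q : is_perm p -> is_perm q ->
  descent_comp p = descent_comp q -> Pk p = Pk q.
Proof.
move=> /andP[up _] /andP[uq _] eqc.
have eqn : size p = size q by rewrite -!sumn_descent_comp eqc.
have eqa i : i.+1 < size p ->
    (nth 0 p i < nth 0 p i.+1) = (nth 0 q i < nth 0 q i.+1).
  case: p q eqc eqn {up uq} => [|x s] [|y t] //= eqc [eqn] lti.
  have := congr1 (fun L => flatten [seq false :: nseq j.-1 true | j <- L]) eqc.
  rewrite !run_lengths_word //= => -[eqw].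
  have := congr1 (fun w => nth false w i) eqw.
  by rewrite !(nth_pairmap 0) // -?eqn.
have eqd r i : uniq r -> i.+1 < size r ->
    (nth 0 r i.+1 < nth 0 r i) = ~~ (nth 0 r i < nth 0 r i.+1).
  move=> ur lti; rewrite -leqNgt ltn_neqAle nth_uniq //; last exact: ltnW.
  by rewrite eqn_leq ltnn.
apply/fsetP => i; rewrite !inE /= -eqn mem_iota.
case: i => [|[|i]] //=; case lti: (_ < _) => //=.
have lti2 : i.+2 < size p.
  by move: lti; case: (size p) => [|[|[|n]]] //=; rewrite subn2 add2n.
by rewrite /is_peak /= (eqd p) // (eqd q) -?eqn // !eqa // ltnW.
Qed.

Lemma mem_perm_of L x : x \in perm_of L = (0 < x <= sumn L).
Proof.
elim: L => [|j L IH] /=; first by case: x.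
rewrite mem_cat mem_iota IH addSn !ltnS (addnC j).
have [lex|ltx] /= := leqP x (sumn L).
  by rewrite (leq_trans lex (leq_addr _ _)).
by rewrite andbF orbF (leq_ltn_trans (leq0n _) ltx).
Qed.

Lemma perm_of_is_perm L : is_perm (perm_of L).
Proof.
apply/andP; split; last by apply/allP => x; rewrite mem_perm_of => /andP[].
elim: L => //= j L IH; rewrite cat_uniq iota_uniq IH andbT /=.
apply/hasPn => x; rewrite mem_perm_of mem_iota => /andP[_ lex].
by rewrite negb_and -leqNgt lex.
Qed.

Lemma perm_of_descent_comp (L : composition) :
  descent_comp (perm_of L) = L.
Proof.
case: L => L /= Lgt0.
have runs s x k j : (forall y, y \in s -> y <= x) ->
    run_lengths x k (iota x.+1 j ++ s) =
    k + j :: (if s is y :: s' then run_lengths y 1 s' else [::]).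
  elim: j x k => [|j IH] x k les /=.
    rewrite addn0; case: s les => [|y s] les //=.
    by rewrite ltnNge les ?mem_head.
  rewrite ltnSn IH ?addnS // => y ys; exact/ltnW/les.
elim: L Lgt0 => [|[|j] L IH] //= Lgt0.
rewrite runs ?add1n; last by move=> y; rewrite mem_perm_of => /andP[_ /leqW].
by rewrite -{2}IH.
Qed.

Lemma PkcE (L : composition) p :
  is_perm p -> descent_comp p = L -> Pkc L = Pk p.
Proof.
move=> p_perm pL; apply: Pk_descent_comp => //; first exact: perm_of_is_perm.
by rewrite perm_of_descent_comp.
Qed.

Lemma pkcE (L : composition) p :
  is_perm p -> descent_comp p = L -> pkc L = pk p.
Proof. by move=> p_perm pL; rewrite /pk -(PkcE p_perm pL). Qed.

(* Main.v *)
(** The moves 1 and 2 turn every composition into one whose parts are 1 or 2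
    and whose last part is 1, and such a composition is determined by its size
    and its peak set.  Move 3 then sorts it into 2, ..., 2, 1, ..., 1, which is
    determined by its size and its number of peaks.  Hence the moves connect
    all st-equivalent compositions, and differences telescope along chains of
    moves. *)
Require Import Defs.
From mathcomp Require Import all_boot all_order all_algebra finmap multiset.
From mathcomp Require Import boolp classical_sets functions.
From mathcomp Require Import zify.
From Stdlib Require Import Relations.

Set Implicit Arguments.
Unset Strict Implicit.
Unset Printing Implicit Defensive.

Import GRing.Theory.

(** * Linear spans *)

Section Span.
Local Open Scope ring_scope.
Variables (R : pzRingType) (V : lmodType R).
Implicit Types (A B : set V) (u v : V).

Lemma lspan_gen A v : A v -> lspan A v.
Proof.
move=> Av; exists 1%N, (fun=> 1), (fun=> v); split=> //.
by rewrite big_ord1 scale1r.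
Qed.

Lemma lspan0 A : lspan A 0.
Proof.
by exists 0%N, (fun=> 0), (fun=> 0); split; [case | rewrite big_ord0].
Qed.

Lemma lspanD A u v : lspan A u -> lspan A v -> lspan A (u + v).
Proof.
move=> [n [c [a [Aa ->]]]] [m [d [b [Ab ->]]]].
exists (n + m)%N,
  (fun i => match fintype.split i with inl j => c j | inr k => d k end),
  (fun i => match fintype.split i with inl j => a j | inr k => b k end).
split=> [i|]; first by case: (fintype.split i).
rewrite big_split_ord /=; congr (_ + _); apply: eq_bigr => i _.
  by rewrite (unsplitK (inl i)).
by rewrite (unsplitK (inr i)).
Qed.

Lemma lspanZ A (k : R) v : lspan A v -> lspan A (k *: v).
Proof.
move=> [n [c [a [Aa ->]]]]; exists n, (fun i => k * c i), a; split=> //.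
by rewrite scaler_sumr; apply: eq_bigr => i _; rewrite scalerA.
Qed.

Lemma lspan_sub A B : (forall v, A v -> lspan B v) ->
  forall v, lspan A v -> lspan B v.
Proof.
move=> AB _ [n [c [a [Aa ->]]]]; apply: (big_ind (lspan B)) => [|u v|i _].
- exact: lspan0.
- exact: lspanD.
- exact/lspanZ/AB.
Qed.

End Span.

(** * From chains of moves to kernels *)

Lemma lspan_F_chain (r : composition -> composition -> Prop) J K :
  clos_refl_sym_trans composition r J K -> lspan (F_diffs r) (F J - F K)%R.
Proof.
elim=> {J K} [J K rJK|J|J K _ IH|J K L _ IH1 _ IH2].
- by apply: lspan_gen; exists J, K.
- by rewrite subrr; exact: lspan0.
- by rewrite -opprB -scaleN1r; exact: lspanZ.
- by rewrite -(subrKA (F K)); exact: lspanD.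
Qed.

Lemma kernel_lspan (T : Type) (st : composition -> T)
    (r : composition -> composition -> Prop) :
  (forall J K, r J K -> st_equiv st J K) ->
  (forall J K, st_equiv st J K -> clos_refl_sym_trans composition r J K) ->
  kernel st = lspan (F_diffs r).
Proof.
move=> r_st st_r; apply/seteqP; split; apply: lspan_sub => _ [J [K [JK ->]]].
  exact/lspan_F_chain/st_r.
by apply: lspan_gen; exists J, K; split=> //; exact: r_st.
Qed.

Lemma st_equiv_chain (T : Type) (st : composition -> T)
    (r : composition -> composition -> Prop) J K :
  (forall J K, r J K -> st_equiv st J K) ->
  clos_refl_sym_trans composition r J K -> st_equiv st J K.
Proof.
move=> r_st; elim=> {J K} [||J K _ []|J K L _ [? ?] _ [? ?]] //.
by split; [transitivity (st K) | transitivity (sumn K)].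
Qed.

(** [nf] is a predicate of normal forms. Since [st] and the size are constant along chains, the
    normal forms reached from [J] and from [K] are equivalent, hence equal, and the two chains join
    there. *)
Lemma st_equiv_connected (T : Type) (st : composition -> T)
    (r : composition -> composition -> Prop) (nf : composition -> Prop) :
  (forall J K, r J K -> st_equiv st J K) ->
  (forall J, exists2 N, clos_refl_sym_trans composition r J N & nf N) ->
  (forall M N, nf M -> nf N -> st_equiv st M N -> M = N) ->
  forall J K, st_equiv st J K -> clos_refl_sym_trans composition r J K.
Proof.
move=> r_st nfP nf_inj J K [stJK sJK].
have [M rJM nfM] := nfP J; have [N rKN nfN] := nfP K.
apply: (rst_trans _ _ _ _ _ rJM); apply: rst_sym; rewrite (_ : M = N) //.
have [stM sM] := st_equiv_chain r_st rJM.
have [stN sN] := st_equiv_chain r_st rKN.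
by apply: nf_inj => //; split; [rewrite -stM -stN | rewrite -sM -sN].
Qed.

(** * Peaks read off from the composition *)

(* A descent of a composition is a peak exactly when it ends a part at least
   2; the last part ends in no descent. *)
Fixpoint peaks (L : seq nat) : seq nat :=
  if L is j :: L' then
    if nilp L' then [::]
    else (if 1 < j then [:: j] else [::]) ++ [seq j + i | i <- peaks L']
  else [::].

Lemma peaks_gt1 L i : i \in peaks L -> 1 < i.
Proof.
elim: L i => //= j L IH i; case: ifP => // _.
rewrite mem_cat => /orP[|/mapP[k /IH k_gt1 ->]].
  by case: ifP => // j_gt1; rewrite inE => /eqP->.
exact: leq_trans k_gt1 (leq_addl _ _).
Qed.

(** Peaks exceed 1, so those of the tail, shifted by [j], lie strictly beyond [j]; the guard [j < i]
    keeps the truncated subtraction honest. *)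
Lemma mem_peaks_cons j L i :
  (i \in peaks (j :: L)) =
  ~~ nilp L && ((1 < j) && (i == j) || (j < i) && (i - j \in peaks L)).
Proof.
rewrite /=; case: ifP => //= _; rewrite mem_cat; congr orb.
  by case: ifP => //=; rewrite inE.
apply/mapP/andP => [[k kL ->]|[ltji iL]]; last by exists (i - j) => //; lia.
by have := peaks_gt1 kL; rewrite addKn; split=> //; lia.
Qed.

Lemma uniq_peaks L : uniq (peaks L).
Proof.
elim: L => //= j L IH; case: ifP => // _.
rewrite cat_uniq (map_inj_uniq (@addnI j)) IH andbT.
case: ifP => _ /=; last by rewrite has_pred0.
apply/hasPn => _ /mapP[k /peaks_gt1 k_gt1 ->]; rewrite inE; lia.
Qed.

Lemma size_perm_of L : size (perm_of L) = sumn L.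
Proof. by elim: L => //= j L IH; rewrite size_cat size_iota IH. Qed.

Lemma mem_Pk p i : (i \in Pk p) = (1 < i < size p) && is_peak p i.
Proof.
rewrite /Pk !inE /= mem_iota; congr andb.
by case: (size p) i => [|[|n]] [|[|i]] //=; rewrite ?subn0 //; lia.
Qed.

Lemma nth_perm_of_le L i : nth 0 (perm_of L) i <= sumn L.
Proof.
have [lti|lei] := ltnP i (size (perm_of L)); last by rewrite nth_default.
by have := mem_nth 0 lti; rewrite mem_perm_of => /andP[].
Qed.

Lemma mem_Pk_perm_of L i : all (ltn 0) L ->
  (i \in Pk (perm_of L)) = (i \in peaks L).
Proof.
elim: L i => [|j L IH] i; first by rewrite mem_Pk /= andbF.
move=> /andP[/= j_gt0 L_gt0]; rewrite mem_peaks_cons -IH // !mem_Pk.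
have L_nil : nilp L = (sumn L == 0).
  by case: L L_gt0 {IH} => //= -[].
rewrite L_nil size_cat size_iota !size_perm_of /is_peak /= !nth_cat !size_iota.
(* Inside the first block the next letter is larger, so there is no peak. *)
case: (ltnP i j) => [ltij|leji].
  have [i_gt1|] := ltnP 1 i; last by lia.
  have -> : i.-2 < j by lia.
  have -> : i.-1 < j by lia.
  rewrite !nth_iota; lia.
(* At the end of the block, the next letter, if any, is smaller; an ascent precedes exactly when the
   block has at least two letters. *)
case: (i =P j) => [->|neij].
  rewrite subnn ltnn; have := nth_perm_of_le L 0.
  have [j_gt1|] := ltnP 1 j; last by lia.
  have -> : j.-2 < j by lia.
  have -> : j.-1 < j by lia.
  rewrite !nth_iota; lia.
(* The first letter of the tail follows a larger letter, so it is no peak. *)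
case: (i =P j.+1) => [->|neij1].
  have -> : j.-1 < j by lia.
  have -> : j.+1.-1 < j = false by lia.
  have := nth_perm_of_le L (j.+1.-1 - j).
  rewrite nth_iota; lia.
(* From here on all three letters compared lie in the tail. *)
have -> : i.-2 < j = false by lia.
have -> : i.-1 < j = false by lia.
have -> : i.-2 - j = (i - j).-2 by lia.
have -> : i.-1 - j = (i - j).-1 by lia.
lia.
Qed.

Lemma PkcP (J K : composition) : Pkc J = Pkc K <-> peaks J =i peaks K.
Proof.
have mem_Pkc (L : composition) i : (i \in Pkc L) = (i \in peaks L).
  exact/mem_Pk_perm_of/parts_gt0.
split=> [eqJK i|eqJK]; first by rewrite -!mem_Pkc eqJK.
by apply/fsetP => i; rewrite !mem_Pkc.
Qed.

Lemma pkc_size (L : composition) : pkc L = size (peaks L).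
Proof.
rewrite -(undup_id (uniq_peaks L)) -card_fseq /pkc /pk; congr (#|` _|).
by apply/fsetP => i; rewrite mem_Pk_perm_of ?parts_gt0 // !inE.
Qed.

(** Whether a part of [s] ends in a peak depends on what follows [s] only through its being
    empty. *)
Lemma peaks_catl s u v : nilp u = nilp v -> peaks u = peaks v ->
  peaks (s ++ u) = peaks (s ++ v).
Proof.
move=> nil_uv eq_uv; elim: s => //= j s ->.
by rewrite /nilp !size_cat !addn_eq0 -!/(nilp _) nil_uv.
Qed.

Lemma size_peaks_catl s u v :
    nilp u = nilp v -> size (peaks u) = size (peaks v) ->
  size (peaks (s ++ u)) = size (peaks (s ++ v)).
Proof.
move=> nil_uv eq_uv; elim: s => //= j s IH.
rewrite /nilp !size_cat !addn_eq0 -!/(nilp _) nil_uv.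
by case: ifP => // _; rewrite !size_cat !size_map IH.
Qed.

(** * Invariance of the statistics under the moves *)

Lemma arrow1_Pkc J K : arrow1 J K -> st_equiv Pkc J K.
Proof.
move=> [s [t [j [j_gt2 eqJ eqK]]]]; split; last first.
  by rewrite eqJ eqK !sumn_cat /=; lia.
apply/PkcP; rewrite eqJ eqK (@peaks_catl s _ (1 :: j.-1 :: t)) //=.
case: ifP => // _; rewrite map_cat -map_comp.
have -> : 1 < j by lia.
have -> : 1 < j.-1 by lia.
(* The new part 1 ends in no peak, and the part [j.-1], still at least 2, ends where [j] did. *)
congr cons; first by rewrite /= add1n prednK //; lia.
apply: eq_map => i /=; lia.
Qed.

Lemma arrow2_Pkc J K : arrow2 J K -> st_equiv Pkc J K.
Proof.
move=> [s [eqJ eqK]]; split; last by rewrite eqJ eqK !sumn_cat.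
by apply/PkcP; rewrite eqJ eqK (@peaks_catl s _ [:: 1; 1]).
Qed.

Lemma arrow3_pkc J K : arrow3 J K -> st_equiv pkc J K.
Proof.
move=> [_ + [s [t [eqJ eqK]]]]; rewrite eqJ last_cat /= => last_t.
split; last by rewrite eqJ eqK !sumn_cat.
rewrite !pkc_size eqJ eqK; apply: size_peaks_catl => //=.
(* An empty [t] would leave 2 as the last part of [J]. So the part 2 is last in neither word and
   contributes one peak to both. *)
by case: t last_t {eqJ eqK} => //= k t _; rewrite !size_map.
Qed.

Lemma st_equiv_pkc J K : st_equiv Pkc J K -> st_equiv pkc J K.
Proof. by rewrite /st_equiv /pkc /pk => -[]; rewrite /Pkc => ->. Qed.

(** * Normal forms for the peak set *)

(** These are the compositions to which neither move 1 nor move 2 applies; the default [1] of [last]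
    admits the empty one. *)
Definition reduced (L : seq nat) : bool :=
  all (fun j => 0 < j <= 2) L && (last 1 L == 1).

Lemma reduced_cons j L : reduced (j :: L) -> reduced L.
Proof.
by case: L => // k L; rewrite /reduced /= => /andP[/and3P[_ -> ->] ->].
Qed.

Lemma chain_reduced (r : composition -> composition -> Prop) J :
  (forall J K, arrow1 J K \/ arrow2 J K -> r J K) ->
  exists2 N, clos_refl_sym_trans composition r J N & reduced N.
Proof.
move=> arrow_r.
have size_le (L : composition) : size L <= sumn L.
  by elim: (parts L) (parts_gt0 L) => //= j s IH /andP[? /IH]; lia.
(* Both moves keep the sum and add one part; as [size_le] bounds the number of parts, this
   difference strictly decreases. *)
have [n] := ubnP (sumn J - size J); elim: n J => // n IH J leJn.
suff [redJ|[K JK ltK]] : reduced J \/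
    exists2 K, arrow1 J K \/ arrow2 J K & sumn K - size K < sumn J - size J.
- by exists J => //; exact: rst_refl.
- have [N KN redN] := IH K (leq_trans ltK leJn).
  by exists N => //; apply: (rst_trans _ _ _ K) => //; exact/rst_step/arrow_r.
have J_gt0 := parts_gt0 J.
have [/allPn[j jJ]|] := boolP (~~ all (fun j => j <= 2) J).
  rewrite -ltnNge => j_gt2; right.
  have [s [t eqJ]] : exists s t, J = s ++ j :: t :> seq nat.
    by case/splitPr: jJ => s t; exists s, t.
  have K_gt0 : all (ltn 0) (s ++ 1 :: j.-1 :: t).
    move: J_gt0; rewrite eqJ !all_cat /= => /and3P[-> _ ->]; lia.
  exists (Composition K_gt0); first by left; exists s, t, j.
  have := size_le (Composition K_gt0).
  rewrite eqJ /= !sumn_cat !size_cat /=; lia.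
rewrite negbK => J_le2.
have J_12 : all (fun j => 0 < j <= 2) J by rewrite all_predI J_gt0.
have [lastJ|lastJ] := boolP (last 1 J == 1).
  by left; rewrite /reduced J_12.
right; have [s eqJ] : exists s, J = s ++ [:: 2] :> seq nat.
  case/lastP: (parts J) J_12 lastJ => [|s x] //.
  rewrite all_rcons last_rcons => /andP[x12 _] x_neq1; exists s.
  by rewrite (_ : x = 2) ?cats1 //; lia.
have K_gt0 : all (ltn 0) (s ++ [:: 1; 1]).
  by move: J_gt0; rewrite eqJ !all_cat => /andP[->].
exists (Composition K_gt0); first by right; exists s.
have := size_le (Composition K_gt0).
rewrite eqJ /= !sumn_cat !size_cat /=; lia.
Qed.

(** The parts are recovered from the left: the first part is 2 exactly when 2 is a peak. *)
Lemma reduced_inj (M N : seq nat) : reduced M -> reduced N ->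
  sumn M = sumn N -> peaks M =i peaks N -> M = N.
Proof.
(* The last part being 1, [L] is nonempty and 2 is a peak of [2 :: L]; in [1 :: L'] it would come
   from a peak 1 of [L']. *)
have neq12 (L L' : seq nat) : reduced (2 :: L) ->
    ~ peaks (2 :: L) =i peaks (1 :: L').
  case: L => // k L _ /(_ 2); rewrite !mem_peaks_cons /=.
  case: (1 \in _) (@peaks_gt1 L' 1) => [/(_ isT) //|_].
  by rewrite !andbF.
elim: M N => [|j M IH] [|k N] redM redN //=; rewrite ?addn0.
- by case/andP: redN => /andP[/andP[k_gt0 _] _] _; lia.
- by case/andP: redM => /andP[/andP[k_gt0 _] _] _; lia.
move=> eqs eqp; suff ejk : j = k.
  rewrite ejk in eqs eqp redM *; move/addnI: eqs => eqs.
  congr cons; apply: (IH _ (reduced_cons redM) (reduced_cons redN) eqs) => i.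
  have nil_sum (L : seq nat) : reduced (k :: L) -> nilp L = (sumn L == 0).
    by case: L => //= -[|x] L //= /andP[/andP[]].
  have nilMN : nilp M = nilp N by rewrite !nil_sum // eqs.
  have [M0|nM0] := boolP (nilp M).
    have N0 : nilp N by rewrite -nilMN.
    by rewrite (nilP M0) (nilP N0).
  (* For [i = 0] the index [k + i] would be the end of the first part, which says nothing about the
     tails. *)
  have [->|i_gt0] := posnP i.
    by apply/idP/idP => /peaks_gt1.
  have := eqp (k + i); rewrite !mem_peaks_cons -nilMN nM0 addKn /=.
  have -> : k + i == k = false by lia.
  have -> : k < k + i by lia.
  by rewrite andbF.
have /andP[/andP[j12 _] _] := redM; have /andP[/andP[k12 _] _] := redN.
case: j j12 redM eqp {eqs} => [|[|[|]]] // _ redM;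
case: k k12 redN => [|[|[|]]] // _ redN eqp.
- by case: (neq12 _ M redN) => i; rewrite eqp.
- by case: (neq12 _ N redM).
Qed.

(** * Normal forms for the peak number *)

Lemma sorted_or_12 (L : seq nat) : all (fun j => 0 < j <= 2) L ->
  (exists s t, L = s ++ [:: 1, 2 & t]) \/
  (exists p q, L = nseq p 2 ++ nseq q 1).
Proof.
elim: L => [|j L IH] /=; first by right; exists 0, 0.
move=> /andP[j12 /IH[[s [t ->]]|[p [q ->]]]]; first by left; exists (j :: s), t.
case: j j12 => [|[|[|]]] // _; last by right; exists p.+1, q.
case: p => [|p]; first by right; exists 0, q.+1.
by left; exists [::], (nseq p 2 ++ nseq q 1).
Qed.

Definition sorted_reduced (L : seq nat) : Prop :=
  reduced L /\ exists p q, L = nseq p 2 ++ nseq q 1.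

(** No part 2 is last, so each one ends in a peak and the number of peaks is the exponent [p]; the
    sum then fixes [q]. *)
Lemma sorted_reducedE (L : seq nat) : sorted_reduced L ->
  L = nseq (size (peaks L)) 2 ++ nseq (sumn L - (size (peaks L)).*2) 1.
Proof.
move=> [/andP[_ lastL] [p [q eqL]]].
suff sz : size (peaks L) = p.
  by rewrite sz {1 2}eqL sumn_cat !sumn_nseq mul1n mul2n addKn.
case: q eqL lastL => [|q] ->; last first.
  move=> _; elim: p => [|p /=].
    by elim: q => // q; exact: (etrans (size_map (addn 1) _)).
  by rewrite /nilp size_cat size_nseq /= addnS /= size_map => ->.
(* Without parts 1, a nonempty word would end in 2. *)
by case: p => // p; rewrite -(addn1 p) nseqD -catA last_cat.
Qed.

(* Weighting the part with 0-based index i by 2^i makes move 3 decrease the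
   total weight. *)
Lemma chain_sorted (r : composition -> composition -> Prop) (J : composition) :
    (forall J K, arrow3 J K -> r J K) -> reduced J ->
  exists2 N, clos_refl_sym_trans composition r J N & sorted_reduced N.
Proof.
move=> arrow_r; pose w := foldr (fun x a => x + a.*2) 0.
have w_catl s u v : w u < w v -> w (s ++ u) < w (s ++ v).
  by move=> ltuv; elim: s => //= x s; rewrite ltn_add2l ltn_double.
have [n] := ubnP (w J); elim: n J => // n IH J leJn redJ.
have /andP[J_12 lastJ] := redJ.
case: (sorted_or_12 J_12) => [[s [t eqJ]]|sJ]; last first.
  by exists J; first exact: rst_refl.
have redK : reduced (s ++ [:: 2, 1 & t]).
  move: redJ; rewrite eqJ /reduced !all_cat !last_cat /=.
  by case: t {eqJ} => //=; rewrite andbF.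
have K_gt0 : all (ltn 0) (s ++ [:: 2, 1 & t]).
  by case/andP: redK => /allP K12 _; apply/allP => x /K12 /andP[].
have ltw : w (s ++ [:: 2, 1 & t]) < w J.
  (* The pair 1, 2 weighs 1 + 4 and the pair 2, 1 weighs 2 + 2; the weight of [t] is unaffected. *)
  by rewrite eqJ; apply: w_catl; rewrite /w /=; lia.
have [||N KN sN] := IH (Composition K_gt0) => //.
  exact: leq_trans ltw leJn.
exists N => //; apply: (rst_trans _ _ _ _ _ _ KN).
apply/rst_step/arrow_r; split.
- by apply: sub_all J_12 => j /andP[].
- by move: lastJ; rewrite eqJ !last_cat => /eqP.
- by exists s, t.
Qed.

Theorem theorem2 :
  kernel Pkc = lspan (F_diffs (fun J K => arrow1 J K \/ arrow2 J K)) /\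
  kernel pkc =
    lspan (F_diffs (fun J K => arrow1 J K \/ arrow2 J K \/ arrow3 J K)).
Proof.
split.
  have arrow_Pkc J K : arrow1 J K \/ arrow2 J K -> st_equiv Pkc J K.
    by case=> [/arrow1_Pkc|/arrow2_Pkc].
  apply: kernel_lspan => //.
  apply: (st_equiv_connected (nf := fun N => reduced N)) => // [J|M N nfM nfN].
    exact: chain_reduced.
  by case=> /PkcP eqp eqs; apply/val_inj/reduced_inj.
set r := fun J K => _.
have arrow_pkc J K : r J K -> st_equiv pkc J K.
  case=> [/arrow1_Pkc/st_equiv_pkc|[/arrow2_Pkc/st_equiv_pkc|/arrow3_pkc]] //.
apply: kernel_lspan => //.
apply: (st_equiv_connected (nf := fun N => sorted_reduced N)) => //.
  move=> J.
  have [|M JM redM] := @chain_reduced r J.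
    by move=> ? ? [?|?]; [left | right; left].
  have [|N MN sN] := @chain_sorted r M _ redM; first by right; right.
  by exists N => //; exact: (rst_trans _ _ _ M).
move=> M N sM sN [eqp eqs]; rewrite !pkc_size in eqp.
apply: val_inj => /=; rewrite (sorted_reducedE sM) (sorted_reducedE sN).
by rewrite eqp eqs.
Qed.
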